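(* Let $(c_n)$ be a sequence of reals and let $p=p(n)=\sqrt{\frac{2\log n+\log\log n+c_n}{n}}$ (assumed to lie in $[0,1]$). Let $\mathbb G_{n,n,p}$ be the random bipartite graph with parts $X,Y$, $|X|=|Y|=n$, in which each of the $n^2$ pairs $xy$ with $x\in X,y\in Y$ is an edge independently with probability $p$. Then $$\lim_{n\to\infty}\Pr[\mathbb G_{n,n,p}\text{ satisfies the double Hall property}]=\begin{cases}0 & \text{if } c_n\to-\infty,\\ e^{-e^{-c}} & \text{if } c_n\to c\in\mathbb R,\\ 1 & \text{if } c_n\to+\infty.\end{cases}$$
   Context: $\log$ is the natural logarithm. For a vertex set $S$, $\Lambda^2(S)$ denotes the set of vertices adjacent to at least two vertices of $S$. A bipartite graph $G=(X,Y)$ with $|X|\ge 2$ satisfies the double Hall property if $|\Lambda^2(S)|\ge |S|$ for every $S\subseteq X$ with $|S|\ge 2$. *)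

(* Defs.v *)
From HB Require Import structures.
From mathcomp Require Import all_boot all_order all_algebra.
From mathcomp Require Import all_classical all_reals all_analysis.
Set Implicit Arguments.
Unset Strict Implicit.
Unset Printing Implicit Defensive.
Import Order.TTheory GRing.Theory Num.Theory.
Import numFieldNormedType.Exports.
Local Open Scope ring_scope.

Section BipartiteGraph.
Variables X Y : finType.

(* A bipartite graph with parts X and Y is given by its set of edges. *)
Definition bigraph := {set X * Y}.

(* Vertices of X are only adjacent to vertices of Y, so for S included in X
   the set Lambda^2(S) is a subset of Y. *)
Definition Lambda2 (G : bigraph) (S : {set X}) : {set Y} :=
  [set y | (2 <= #|[set x in S | (x, y) \in G]|)%N].

Definition double_Hall (G : bigraph) : bool :=
  (2 <= #|X|)%N &&
  [forall S : {set X}, (2 <= #|S|)%N ==> (#|S| <= #|Lambda2 G S|)%N].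

End BipartiteGraph.

Section RandomBipartiteGraph.
Variables (R : realType) (n : nat) (p : R).

(* The product law: the pairs are edges independently, with probability p. *)
Definition Gnnp_law (G : bigraph 'I_n 'I_n) : R :=
  \prod_(xy : 'I_n * 'I_n) (if xy \in G then p else 1 - p).

Definition Gnnp_Pr (A : pred (bigraph 'I_n 'I_n)) : R :=
  \sum_(G : bigraph 'I_n 'I_n | A G) Gnnp_law G.

End RandomBipartiteGraph.

Section EdgeProbability.
Variables (R : realType) (c : nat -> R) (n : nat).

Definition edge_prob_sqr : R := (2 * ln n%:R + ln (ln n%:R) + c n) / n%:R.

Definition edge_prob : R := Num.sqrt edge_prob_sqr.

(* The first conjunct is needed because Num.sqrt is 0 on negative numbers. *)
Definition edge_prob_valid : Prop := 0 <= edge_prob_sqr /\ 0 <= edge_prob <= 1.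

End EdgeProbability.

(* Main.v *)
Require Import Defs.
From HB Require Import structures.
From mathcomp Require Import all_classical all_reals all_analysis.
From mathcomp Require Import all_boot all_order all_algebra.
From mathcomp Require Import ring lra.

(** The double Hall property is increasing, so its probability is monotone in
    the edge probability, and the limits for [c n --> -oo] and [c n --> +oo]
    follow from the limit for constant sequences.

    Let [c n] converge to [c0], and write [L = ln n], so that [n p^2] is
    [2 L + ln L + c n].  Call [S] deficient if [|Lambda^2(S)| < |S|].  Two
    vertices of [X] have at most one common neighbour with probability
    asymptotic to [2 exp(-c0) / n^2]; on average about [exp(-c0)] pairs are thus
    deficient.  Disjoint pairs behave independently, and two pairs sharing a
    vertex are both deficient with probability [o(n^-3)] by a Chernoff bound.
    Removing the pairs one at a time, the probability that no pair is deficient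
    differs from [(1 - Pr[deficient])^C(n,2)] by at most the sum of
    [Pr[both deficient] + Pr[deficient]^2] over dependent pairs, which tends
    to [0].

    A union bound shows that w.h.p. no larger set is deficient: for a deficient
    set of size [k], some [n - k + 1] vertices of [Y] have at most one neighbour
    in it, and each vertex does so with probability
    [(1 - p)^(k - 1) (1 + (k - 1) p)]. *)

Set Implicit Arguments.
Unset Strict Implicit.
Unset Printing Implicit Defensive.
Import Order.TTheory GRing.Theory Num.Theory.
Import numFieldNormedType.Exports.
Local Open Scope ring_scope.

(** * Random subsets of a finite type *)

Lemma exists_subset_card (T : finType) (A : {set T}) k : (k <= #|A|)%N ->
  exists2 B : {set T}, B \subset A & #|B| = k.
Proof.
case/card_geqP => s [us <- sA]; exists [set x in s].
  by apply/subsetP => x; rewrite inE => /sA.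
by rewrite cardsE; apply/card_uniqP.
Qed.

Section RandomSubset.
Variables (R : realFieldType) (T : finType).
Implicit Types (p q : R) (A B D K S : {set T}) (f g : {set T} -> R).
Implicit Types (E F : pred {set T}).

Definition rset_law p A : R := \prod_x (if x \in A then p else 1 - p).

Definition rset_E p f : R := \sum_A rset_law p A * f A.

Definition rset_Pr p E : R := \sum_(A | E A) rset_law p A.

Lemma rset_PrE p E : rset_Pr p E = rset_E p (fun A => (E A)%:R).
Proof.
by rewrite /rset_Pr big_mkcond; apply: eq_bigr => A _; rewrite -mulrb mulr_natr.
Qed.

Lemma eq_rset_E p f g : f =1 g -> rset_E p f = rset_E p g.
Proof. by move=> fg; apply: eq_bigr => A _; rewrite fg. Qed.

Lemma eq_rset_Pr p E E' : E =1 E' -> rset_Pr p E = rset_Pr p E'.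
Proof. exact: eq_bigl. Qed.

Lemma rset_ED p f g : rset_E p (fun A => f A + g A) = rset_E p f + rset_E p g.
Proof. by rewrite -big_split; apply: eq_bigr => A _; rewrite mulrDr. Qed.

Lemma rset_EZ p k f : rset_E p (fun A => k * f A) = k * rset_E p f.
Proof. by rewrite mulr_sumr; apply: eq_bigr => A _; rewrite mulrCA. Qed.

Lemma rset_E_sum p (I : Type) (r : seq I) (P : pred I) (h : I -> {set T} -> R) :
  rset_E p (fun A => \sum_(i <- r | P i) h i A) =
  \sum_(i <- r | P i) rset_E p (h i).
Proof.
by rewrite /rset_E exchange_big; apply: eq_bigr => A _; rewrite mulr_sumr.
Qed.

Lemma rset_E_prod p (F : T -> bool -> R) :
  rset_E p (fun A => \prod_x F x (x \in A)) =
  \prod_x (p * F x true + (1 - p) * F x false).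
Proof.
pose G x (b : bool) := (if b then p else 1 - p) * F x b.
transitivity (\prod_x \sum_(b : bool) G x b); last first.
  by apply: eq_bigr => x _; rewrite big_bool.
rewrite bigA_distr_bigA (reindex (fun A : {set T} => [ffun x => x \in A])) /=.
  apply: eq_bigr => A _; rewrite -big_split; apply: eq_bigr => x _.
  by rewrite ffunE.
exists (fun h : {ffun T -> bool} => [set x | h x]) => [A|h] _.
  by apply/setP => x; rewrite inE ffunE.
by apply/ffunP => x; rewrite ffunE inE.
Qed.

Lemma rset_E_cst p k : rset_E p (fun=> k) = k.
Proof.
suff E1 : rset_E p (fun=> 1) = 1.
  by rewrite -[RHS]mulr1 -E1 -rset_EZ; apply: eq_rset_E => A; rewrite mulr1.
transitivity (\prod_(x : T) (p * 1 + (1 - p) * 1)).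
  rewrite -(rset_E_prod p (fun _ _ => 1)).
  by apply: eq_rset_E => A; rewrite big1.
by rewrite big1// => x _; rewrite !mulr1 addrC subrK.
Qed.

Lemma rset_PrID p F E :
  rset_Pr p E =
  rset_Pr p (fun A => E A && F A) + rset_Pr p (fun A => E A && ~~ F A).
Proof. exact: bigID. Qed.

Lemma rset_PrT p : rset_Pr p predT = 1.
Proof. by rewrite rset_PrE rset_E_cst. Qed.

Lemma rset_PrC p E : rset_Pr p (predC E) = 1 - rset_Pr p E.
Proof.
by rewrite -(rset_PrT p) [rset_Pr p predT](rset_PrID p E) /= addrAC subrr add0r.
Qed.

(* When the points are labelled independently with law [w], those whose label is
   in [D] form a random subset. *)
Lemma sum_ffun_preim (J : finType) (w : J -> R) (D : pred J) f :
  \sum_j w j = 1 ->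
  \sum_(h : {ffun T -> J}) (\prod_x w (h x)) * f [set x | D (h x)] =
  rset_E (\sum_(j | D j) w j) f.
Proof.
move=> w1; set p := \sum_(j | D j) w j.
rewrite (partition_big (fun h : {ffun T -> J} => [set x | D (h x)]) predT)//=.
apply: eq_bigr => K _.
transitivity (\sum_(h in family (fun x j => D j == (x \in K)))
    (\prod_x w ((h : {ffun T -> J}) x)) * f K).
  apply: eq_big => [h|h /eqP-> //]; apply/eqP/familyP => [<- x|hK].
    by rewrite -topredE /= inE.
  by apply/setP => x; rewrite inE; apply/eqP/(hK x).
rewrite -mulr_suml -(bigA_distr_big_dep _ (fun=> w)); congr (_ * _).
apply: eq_bigr => x _.
case: (x \in K); first by apply: eq_bigl => j; rewrite eqb_id.
rewrite -w1 [\sum_j w j](bigID D) /= -/p addrAC subrr add0r.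
by apply: eq_bigl => j; rewrite eqbF_neg.
Qed.

(* Exchanging the two sets outside [D] preserves the law of an independent pair
   [(A, B)], and turns [f A * g A] into [f A * g B]. *)
Lemma rset_E_indep p D f g :
  (forall A, f (A :&: D) = f A) -> (forall A, g (A :\: D) = g A) ->
  rset_E p (fun A => f A * g A) = rset_E p f * rset_E p g.
Proof.
move=> fD gD; pose mix A B := (A :&: D) :|: (B :\: D).
have mixI A B : mix A B :&: D = A :&: D.
  apply/setP => x; rewrite !inE.
  by case: (x \in D); rewrite ?andbF ?andbT ?orbF.
have mixD A B : mix A B :\: D = B :\: D.
  by apply/setP => x; rewrite !inE; case: (x \in D); rewrite ?andbF.
have mixK A B : mix (mix A B) (mix B A) = A by rewrite {1}/mix mixI mixD setID.
have law_mix A B :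
    rset_law p (mix A B) * rset_law p (mix B A) = rset_law p A * rset_law p B.
  rewrite -!big_split; apply: eq_bigr => x _; rewrite !inE.
  by case: (x \in D); rewrite /= ?andbF ?andbT ?orbF// mulrC.
rewrite -[LHS]mulr1 -[in LHS](rset_E_cst p 1) !big_distrlr !pair_big /=.
rewrite (reindex (fun u => (mix u.1 u.2, mix u.2 u.1))) /=; last first.
  by exists (fun u => (mix u.1 u.2, mix u.2 u.1)) => -[A B] _ /=; rewrite !mixK.
apply: eq_bigr => -[A B] _ /=.
rewrite -[f (mix _ _)]fD mixI fD -[g (mix _ _)]gD mixD gD.
by rewrite mulr1 mulrAC law_mix mulrACA.
Qed.

Section Probability.
Variable p : R.
Hypothesis p01 : 0 <= p <= 1.

Lemma rset_law_ge0 A : 0 <= rset_law p A.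
Proof.
case/andP: p01 => p0 p1; apply: prodr_ge0 => x _.
by case: ifP; rewrite ?subr_ge0.
Qed.

Lemma rset_E_le f g : (forall A, f A <= g A) -> rset_E p f <= rset_E p g.
Proof.
by move=> fg; apply: ler_sum => A _; rewrite ler_wpM2l ?rset_law_ge0.
Qed.

Lemma rset_Pr_ge0 E : 0 <= rset_Pr p E.
Proof. by apply: sumr_ge0 => A _; exact: rset_law_ge0. Qed.

Lemma rset_Pr_le1 E : rset_Pr p E <= 1.
Proof. by rewrite -subr_ge0 -rset_PrC rset_Pr_ge0. Qed.

Lemma rset_Pr_sub E E' : subpred E E' -> rset_Pr p E <= rset_Pr p E'.
Proof.
move=> EE'; rewrite !rset_PrE; apply: rset_E_le => A; rewrite ler_nat.
by case: (E A) (EE' A) => // ->.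
Qed.

Lemma rset_Pr_le_sum (I : Type) (r : seq I) (P : pred I) E
    (H : I -> pred {set T}) :
  (forall A, E A -> has (fun i => P i && H i A) r) ->
  rset_Pr p E <= \sum_(i <- r | P i) rset_Pr p (H i).
Proof.
move=> EH; under eq_bigr do rewrite rset_PrE.
rewrite -rset_E_sum rset_PrE; apply: rset_E_le => A.
case: (boolP (E A)) => [/EH|_]; last by rewrite sumr_ge0.
elim: r {EH} => //= i r IH; rewrite big_cons; case: (P i) => //=.
by case: (H i A) => [_|/IH]; rewrite ?add0r// lerDl sumr_ge0.
Qed.

Lemma rset_Pr_le_add E E1 E2 : (forall A, E A -> E1 A || E2 A) ->
  rset_Pr p E <= rset_Pr p E1 + rset_Pr p E2.
Proof.
move=> EE; have := @rset_Pr_le_sum bool [:: true; false] predT E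
  (fun b => if b then E1 else E2).
by rewrite !big_cons big_nil addr0; apply=> A /EE /=; rewrite orbF.
Qed.

End Probability.

(* Coupling: throw each point into state 0, 1 or 2 with probability [p], [q - p]
   and [1 - q]; the points in state 0 form a [p]-random subset of the [q]-random
   set of points in state 0 or 1. *)
Lemma rset_E_mono p q f : 0 <= p -> p <= q -> q <= 1 ->
  {homo f : A B / A \subset B >-> A <= B} -> rset_E p f <= rset_E q f.
Proof.
move=> p0 pq q1 fhomo; pose w (j : 'I_3) := [:: p; q - p; 1 - q]`_j.
have w1 : \sum_j w j = 1 by rewrite !big_ord_recl big_ord0 /w /=; ring.
have w0 j : 0 <= w j by case: j => -[|[|[|//]]] ?; rewrite /w /= ?subr_ge0.
have pE : \sum_(j | j == 0) w j = p by rewrite big_pred1_eq.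
have qE : \sum_(j | j != 2) w j = q.
  by rewrite big_mkcond !big_ord_recl big_ord0 /w /=; ring.
rewrite -pE -qE -!sum_ffun_preim//; apply: ler_sum => h _.
apply: ler_wpM2l; first exact: prodr_ge0.
by apply: fhomo; apply/subsetP => x; rewrite !inE => /eqP ->.
Qed.

Lemma rset_Pr_mono p q E : 0 <= p -> p <= q -> q <= 1 ->
  {homo E : A B / A \subset B >-> A ==> B} -> rset_Pr p E <= rset_Pr q E.
Proof.
move=> p0 pq q1 Ehomo; rewrite !rset_PrE; apply: rset_E_mono => // A B AB.
by rewrite ler_nat; case: (E A) (Ehomo _ _ AB) => //= ->.
Qed.

Lemma rset_Pr_forall p (Q : T -> pred bool) :
  rset_Pr p (fun A => [forall x, Q x (x \in A)]) =
  \prod_x (p * (Q x true)%:R + (1 - p) * (Q x false)%:R).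
Proof.
rewrite rset_PrE -(rset_E_prod p (fun x b => (Q x b)%:R)).
apply: eq_rset_E => A.
have -> : [forall x, Q x (x \in A)] = \big[andb/true]_x Q x (x \in A).
  by rewrite big_andE.
by apply: (big_morph (fun b : bool => b%:R)) => // a b; rewrite -natrM mulnb.
Qed.

Lemma rset_Pr_setI_eq p S B : B \subset S ->
  rset_Pr p (fun A => A :&: S == B) = p ^+ #|B| * (1 - p) ^+ (#|S| - #|B|).
Proof.
move=> BS; pose Q x b := (x \in S) ==> (b == (x \in B)).
transitivity (rset_Pr p (fun A => [forall x, Q x (x \in A)])).
  apply: eq_rset_Pr => A; rewrite /Q; apply/eqP/forallP => [<- x|AB].
    by apply/implyP => xS; rewrite inE xS andbT.
  apply/setP => x; rewrite inE; have := AB x; have := subsetP BS x.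
  case: (x \in S) => /= [_ /eqP->|]; first by rewrite andbT.
  by rewrite andbF; case: (x \in B) => // ->.
rewrite rset_Pr_forall (bigID (mem B)) /= -prodr_const; congr (_ * _).
  by apply: eq_bigr => x xB; rewrite /Q (subsetP BS)// xB /=; ring.
rewrite (bigID (mem S)) /= mulrC big1 => [|x /andP[_ /negPf xS]]; last first.
  by rewrite /Q xS /=; ring.
rewrite mul1r -cardsDS// -prodr_const.
apply: eq_big => [x|x /andP[/negPf xB xS]]; first by rewrite inE.
by rewrite /Q xB xS /=; ring.
Qed.

Lemma rset_Pr_subset p S : rset_Pr p (fun A => S \subset A) = p ^+ #|S|.
Proof.
have := rset_Pr_setI_eq p (subxx S); rewrite subnn expr0 mulr1 => <-.
by apply: eq_rset_Pr => A; rewrite (sameP setIidPr eqP).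
Qed.

(* The probability that a binomial variable with parameters [k] and [p] is at
   most 1, written so as to be 1 for [k = 0]. *)
Definition card_le1_prob k p : R := (1 - p) ^+ k.-1 * (1 + k.-1%:R * p).

Lemma rset_Pr_card_setI_le1 p S :
  rset_Pr p (fun A => #|A :&: S| <= 1)%N = card_le1_prob #|S| p.
Proof.
transitivity (rset_Pr p (fun A => A :&: S == set0) +
    \sum_(x in S) rset_Pr p (fun A => A :&: S == [set x])).
  rewrite !rset_PrE; under [X in _ + X]eq_bigr do rewrite rset_PrE.
  rewrite -rset_E_sum -rset_ED; apply: eq_rset_E => A.
  have [->|[x xAS]] := set_0Vmem (A :&: S).
    rewrite cards0 eqxx big1 ?addr0// => y yS.
    by rewrite eq_sym -cards_eq0 cards1.
  have xS : x \in S by have := subsetP (subsetIr A S) x xAS.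
  have -> : (A :&: S == set0) = false.
    by apply/negbTE/set0Pn; exists x.
  rewrite add0r (bigD1 x)//= big1 => [|y /andP[_ /negPf yx]]; last first.
    by case: eqP => // ASy; move: xAS; rewrite ASy inE eq_sym yx.
  rewrite addr0; congr (nat_of_bool _)%:R.
  by rewrite eq_sym eqEcard sub1set xAS cards1.
rewrite (rset_Pr_setI_eq p (sub0set S)) cards0 subn0 mul1r.
rewrite (eq_bigr (fun=> p * (1 - p) ^+ #|S|.-1)) => [|x xS]; last first.
  by rewrite (@rset_Pr_setI_eq p S) ?sub1set// cards1 subn1.
rewrite sumr_const /card_le1_prob; case: #|S| => [|k] /=; first by ring.
by rewrite exprS -[_ *+ _]mulr_natl -natr1 /=; ring.
Qed.

Lemma rset_Pr_card_le p k : 0 <= p <= 1 -> (k <= #|T|)%N ->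
  rset_Pr p (fun A => #|A| <= k)%N <= 'C(#|T|, k)%:R * (1 - p) ^+ (#|T| - k).
Proof.
move=> p01 kT; pose missed K := #|K| == (#|T| - k)%N.
apply: (@le_trans _ _
  (\sum_(K | missed K) rset_Pr p (fun A => A :&: K == set0))).
  apply: rset_Pr_le_sum => // A Ak.
  have [|K KA Kk] := @exists_subset_card _ (~: A) (#|T| - k).
    by rewrite cardsCs setCK leq_sub2l.
  apply/hasP; exists K; first exact: mem_index_enum.
  by rewrite /missed Kk eqxx setI_eq0 disjoint_sym disjoints_subset.
rewrite (eq_bigr (fun=> (1 - p) ^+ (#|T| - k))) => [|K /eqP Kk]; last first.
  by rewrite (rset_Pr_setI_eq p (sub0set K)) cards0 subn0 Kk mul1r.
by rewrite sumr_const -bin_sub// -card_draws mulr_natl cardsE.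
Qed.

End RandomSubset.

Lemma card_le1_prob_itv (R : realFieldType) k (p : R) : 0 <= p <= 1 ->
  0 <= card_le1_prob k p <= 1.
Proof.
move=> p01; have := rset_Pr_card_setI_le1 p [set: 'I_k].
by rewrite cardsT card_ord => <-; rewrite rset_Pr_ge0 ?rset_Pr_le1.
Qed.

Lemma bernoulli_onem_expn (R : realFieldType) m (p : R) : 0 <= p <= 1 ->
  1 - m%:R * p <= (1 - p) ^+ m.
Proof.
move=> /andP[p0 p1]; elim: m => [|m IH]; first by rewrite mul0r subr0.
have mp2 : 0 <= m%:R * (p * p) by rewrite !mulr_ge0.
have p10 : 0 <= 1 - p by rewrite subr_ge0.
by rewrite exprS -natr1; have := ler_wpM2l p10 IH; lra.
Qed.

(* Bonferroni's inequality for the number of pairs of successes. *)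
Lemma card_le1_prob_le (R : realFieldType) k (p : R) : 0 <= p <= 1 ->
  card_le1_prob k p <= 1 - 'C(k, 2)%:R * p ^+ 2 + 2 * 'C(k, 3)%:R * p ^+ 3.
Proof.
move=> p01; case: k => [|m].
  by rewrite /card_le1_prob !bin_small//= expr0; lra.
elim: m => [|m IH]; first by rewrite /card_le1_prob !bin_small//= expr0; lra.
have -> : card_le1_prob m.+2 p =
    card_le1_prob m.+1 p - m.+1%:R * p ^+ 2 * (1 - p) ^+ m.
  by rewrite /card_le1_prob /= exprS -natr1; ring.
have bin2E : 2 * 'C(m.+1, 2)%:R = m.+1%:R * m%:R :> R.
  by rewrite -!natrM -mul_bin_diag bin1.
have mp2 : 0 <= m.+1%:R * p ^+ 2 by rewrite mulr_ge0 ?sqr_ge0.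
have := ler_wpM2l mp2 (bernoulli_onem_expn m p01).
have -> : m.+1%:R * p ^+ 2 * (1 - m%:R * p) =
    m.+1%:R * p ^+ 2 - m.+1%:R * m%:R * p ^+ 3 by ring.
have binSE j : 'C(m.+2, j.+1)%:R = 'C(m.+1, j.+1)%:R + 'C(m.+1, j)%:R :> R.
  by rewrite binS natrD.
rewrite -bin2E !binSE bin1; lra.
Qed.

Definition none_of (T I : Type) (B : I -> pred T) (s : seq I) : pred T :=
  fun x => all (fun i => ~~ B i x) s.

Section DependencySieve.
Variables (R : realFieldType) (T : finType) (I : eqType) (p : R).
Variables (B : I -> pred {set T}) (dep : rel I).
Hypothesis p01 : 0 <= p <= 1.
Hypothesis indep : forall i s, all (fun j => ~~ dep i j) s ->
  rset_Pr p (fun A => B i A && none_of B s A) =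
  rset_Pr p (B i) * rset_Pr p (none_of B s).

Local Notation Pr := (rset_Pr p).
Local Notation joint i j := (fun A => B i A && B j A).

Lemma none_of_filter_le (C : pred {set T}) (d : pred I) s :
  Pr (fun A => C A && none_of B [seq j <- s | ~~ d j] A) <=
  Pr (fun A => C A && none_of B s A) +
  \sum_(j <- s | d j) Pr (fun A => C A && B j A).
Proof.
pose some_d A := has (fun j => d j && (C A && B j A)) s.
apply: (@le_trans _ _
  (Pr (fun A => C A && none_of B s A) + Pr some_d)); last first.
  by rewrite lerD2l; apply: rset_Pr_le_sum.
apply: rset_Pr_le_add => // A; rewrite /some_d; case: (C A) => //=.
elim: s {some_d} => //= j s; rewrite /none_of /=.
by case: (d j) => /=; case: (B j A) => //=; rewrite orbT.
Qed.

(* Without the events depending on [B i], avoiding [s] would be independent of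
   [B i]; dropping them costs at most the right-hand side. *)
Lemma rset_Pr_none_of_cons_approx i s :
  `|Pr (none_of B (i :: s)) - (1 - Pr (B i)) * Pr (none_of B s)| <=
  \sum_(j <- s | dep i j) (Pr (joint i j) + Pr (B i) * Pr (B j)).
Proof.
pose s' := [seq j <- s | ~~ dep i j].
have subs' A : none_of B s A -> none_of B s' A.
  by rewrite /none_of all_filter; apply: sub_all => j /= ->; rewrite implybT.
have PrBs' :
    Pr (fun A => B i A && none_of B s' A) = Pr (B i) * Pr (none_of B s').
  by apply: indep; rewrite all_filter; apply/allP => j _; apply/implyP.
have PrBs_le :
    Pr (fun A => B i A && none_of B s A) <= Pr (B i) * Pr (none_of B s').
  by rewrite -PrBs'; apply: rset_Pr_sub => // A /andP[-> /subs'].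
have PrBs_ge := none_of_filter_le (B i) (dep i) s.
have Prs_le : Pr (none_of B s) <= Pr (none_of B s') by exact: rset_Pr_sub.
have Prs_ge : Pr (none_of B s') <=
    Pr (none_of B s) + \sum_(j <- s | dep i j) Pr (B j).
  exact: (none_of_filter_le predT (dep i) s).
rewrite PrBs' in PrBs_ge.
have -> : Pr (none_of B (i :: s)) =
    Pr (none_of B s) - Pr (fun A => B i A && none_of B s A).
  rewrite (rset_PrID p (B i) (none_of B s)) addrAC.
  rewrite [X in X - _](@eq_rset_Pr _ _ _ _ (fun A => B i A && none_of B s A)).
    by rewrite subrr add0r; apply: eq_rset_Pr => A; rewrite /none_of /= andbC.
  by move=> A; rewrite andbC.
have B0 := rset_Pr_ge0 p01 (B i).
have := ler_wpM2l B0 Prs_le; have := ler_wpM2l B0 Prs_ge.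
have : 0 <= \sum_(j <- s | dep i j) Pr (joint i j).
  by apply: sumr_ge0 => j _; apply: rset_Pr_ge0.
have : 0 <= Pr (B i) * \sum_(j <- s | dep i j) Pr (B j).
  by rewrite mulr_ge0// sumr_ge0// => j _; apply: rset_Pr_ge0.
rewrite big_split /= -mulr_sumr ler_norml; lra.
Qed.

Lemma rset_Pr_none_of_approx s : uniq s ->
  `|Pr (none_of B s) - \prod_(i <- s) (1 - Pr (B i))| <=
  \sum_(i <- s) \sum_(j <- s | dep i j && (j != i))
     (Pr (joint i j) + Pr (B i) * Pr (B j)).
Proof.
have term_ge0 i j : 0 <= Pr (joint i j) + Pr (B i) * Pr (B j).
  by rewrite addr_ge0 ?mulr_ge0 ?rset_Pr_ge0.
elim: s => [_|i s IH /= /andP[si us]].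
  by rewrite !big_nil [Pr _]rset_PrT subrr normr0.
rewrite !big_cons eqxx andbF.
rewrite -(subrK ((1 - Pr (B i)) * Pr (none_of B s)) (Pr (none_of B (i :: s)))).
rewrite -addrA -mulrBr; apply: le_trans (ler_normD _ _) (lerD _ _).
  apply: le_trans (rset_Pr_none_of_cons_approx i s) _.
  rewrite [leLHS]big_seq_cond [leRHS]big_seq_cond [leLHS](eq_bigl (fun j =>
    (j \in s) && (dep i j && (j != i))))// => j.
  by case: (boolP (j \in s)) => //= js; rewrite (memPn si)// andbT.
apply: le_trans (le_trans (IH us) _); last first.
  apply: ler_sum => k _; rewrite big_cons.
  by case: ifP => // _; rewrite lerDr.
rewrite normrM ler_piMl// ger0_norm ?subr_ge0 ?rset_Pr_le1//.
by rewrite gerBl rset_Pr_ge0.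
Qed.

End DependencySieve.

(** * Random bipartite graphs *)

Section RandomBigraph.
Variables (R : realFieldType) (X Y : finType).
Implicit Types (p : R) (G H : bigraph X Y) (D S : {set X}).

Definition column G y : {set X} := [set x | (x, y) \in G].

Lemma rset_E_columns p (F : {ffun Y -> {set X}} -> R) :
  rset_E p (fun G : bigraph X Y => F [ffun y => column G y]) =
  \sum_(h : {ffun Y -> {set X}}) (\prod_y rset_law p (h y)) * F h.
Proof.
rewrite [RHS](reindex (fun G : bigraph X Y => [ffun y => column G y])) /=.
  apply: eq_bigr => G _; congr (_ * _).
  under [RHS]eq_bigr do rewrite ffunE.
  rewrite /rset_law exchange_big pair_big /=; apply: eq_bigr => -[x y] _.
  by rewrite inE.
exists (fun h => [set xy | xy.1 \in (h : {ffun Y -> {set X}}) xy.2]) => [G|h] _.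
  by apply/setP => -[x y]; rewrite inE ffunE inE.
by apply/ffunP => y; rewrite ffunE; apply/setP => x; rewrite !inE.
Qed.

Lemma rset_E_columns_prod p (f : Y -> {set X} -> R) :
  rset_E p (fun G : bigraph X Y => \prod_y f y (column G y)) =
  \prod_y rset_E p (f y).
Proof.
rewrite bigA_distr_bigA; under [RHS]eq_bigr do rewrite big_split.
rewrite -(rset_E_columns p (fun h => \prod_y f y (h y))).
by apply: eq_rset_E => G; under [RHS]eq_bigr do rewrite ffunE.
Qed.

Lemma rset_Pr_columns_preim p (D : pred {set X}) (E : pred {set Y}) :
  rset_Pr p (fun G : bigraph X Y => E [set y | D (column G y)]) =
  rset_Pr (rset_Pr p D) E.
Proof.
have law1 : \sum_(A : {set X}) rset_law p A = 1 by exact: rset_PrT.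
rewrite [LHS]rset_PrE [RHS]rset_PrE.
rewrite -(sum_ffun_preim D (fun B => (E B)%:R) law1).
rewrite -(rset_E_columns p (fun h => (E [set y | D (h y)])%:R)).
apply: eq_rset_E => G; congr (nat_of_bool (E _))%:R.
by apply/setP => y; rewrite !inE ffunE.
Qed.

Lemma Lambda2_column G S :
  Lambda2 G S = [set y | (2 <= #|column G y :&: S|)%N].
Proof.
apply/setP => y; rewrite !inE; congr (2 <= _)%N.
by apply: eq_card => x; rewrite !inE andbC.
Qed.

Lemma Lambda2_pair G S : #|S| = 2%N ->
  Lambda2 G S = [set y | S \subset column G y].
Proof.
move=> S2; rewrite Lambda2_column; apply/setP => y.
by rewrite !inE (sameP setIidPr eqP) eqEcard subsetIr S2.
Qed.

Lemma Lambda2_setI G D S : S \subset D ->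
  Lambda2 (G :&: [set xy | xy.1 \in D]) S = Lambda2 G S.
Proof.
move=> SD; apply/setP => y; rewrite !inE; congr (2 <= _)%N.
apply: eq_card => x; rewrite !inE.
by case xS : (x \in S); rewrite //= (subsetP SD) ?andbT.
Qed.

Lemma Lambda2S G H S : G \subset H -> Lambda2 G S \subset Lambda2 H S.
Proof.
move=> GH; apply/subsetP => y; rewrite !inE => /leq_trans; apply.
apply: subset_leq_card; apply/subsetP => x; rewrite !inE => /andP[->] /=.
exact: (subsetP GH).
Qed.

Lemma double_Hall_homo :
  {homo @double_Hall X Y : G H / G \subset H >-> G ==> H}.
Proof.
move=> G H GH; apply/implyP => /andP[X2 /forallP dH]; rewrite /double_Hall X2.
apply/forallP => S; apply/implyP => S2; have := dH S; rewrite S2 => /leq_trans.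
by apply; apply/subset_leq_card/Lambda2S.
Qed.

Definition deficient S : pred (bigraph X Y) :=
  fun G => (#|Lambda2 G S| < #|S|)%N.

Lemma double_HallE G : (2 <= #|X|)%N ->
  double_Hall G = [forall S : {set X}, (2 <= #|S|)%N ==> ~~ deficient S G].
Proof.
move=> X2; rewrite /double_Hall X2.
by apply: eq_forallb => S; rewrite /deficient -leqNgt.
Qed.

Lemma rset_Pr_deficient p S :
  rset_Pr p (deficient S) =
  rset_Pr (1 - card_le1_prob #|S| p) (fun B : {set Y} => #|B| < #|S|)%N.
Proof.
rewrite -rset_Pr_card_setI_le1 -rset_PrC -rset_Pr_columns_preim.
apply: eq_rset_Pr => G; rewrite /deficient Lambda2_column; congr (_ < _)%N.
by apply: eq_card => y; rewrite !inE ltnNge.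
Qed.

(* The common neighbours of a pair form a [p ^+ 2]-random set. *)
Definition deficient_pair_prob (m : nat) p : R := card_le1_prob m (p ^+ 2).

Lemma rset_Pr_deficient_pair p S : #|S| = 2%N ->
  rset_Pr p (deficient S) = deficient_pair_prob #|Y| p.
Proof.
move=> S2; rewrite rset_Pr_deficient S2.
rewrite /deficient_pair_prob -cardsT -rset_Pr_card_setI_le1.
have -> : 1 - card_le1_prob 2 p = p ^+ 2 by rewrite /card_le1_prob /=; ring.
by apply: eq_rset_Pr => B; rewrite setIT.
Qed.

Lemma rset_Pr_deficient_le p S : 0 <= p <= 1 -> (0 < #|S|)%N ->
    (#|S| <= #|Y|.+1)%N ->
  rset_Pr p (deficient S) <=
  'C(#|Y|, #|S|.-1)%:R * card_le1_prob #|S| p ^+ (#|Y| - #|S|.-1).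
Proof.
move=> p01 S0 SY; have := card_le1_prob_itv #|S| p01 => q01.
have := @rset_Pr_card_le _ Y (1 - card_le1_prob #|S| p) #|S|.-1.
rewrite opprB addrCA subrr addr0 => le_bin.
rewrite rset_Pr_deficient; apply: le_trans (le_bin _ _).
- by apply: rset_Pr_sub => [|B]; [lra|rewrite -{1}(prednK S0) ltnS].
- by lra.
- by rewrite -ltnS prednK.
Qed.

(* Chernoff's method: a deficient pair has at most one common neighbour, so
   [1 - s] is at most [1 - s] to the power of their number. *)
Lemma rset_Pr_deficient2_le p s (S S' : {set X}) : 0 <= p <= 1 -> 0 <= s <= 1 ->
    #|S| = 2%N -> #|S'| = 2%N ->
  (1 - s) ^+ 2 * rset_Pr p (fun G => deficient S G && deficient S' G) <=
  (1 - 2 * s * p ^+ 2 + s ^+ 2 * p ^+ #|S :|: S'|) ^+ #|Y|.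
Proof.
move=> p01 /andP[s0 s1] S2 S'2.
pose z (A Q : {set X}) : R := 1 - s * (Q \subset A)%:R.
have E_subset (Q : {set X}) : rset_E p (fun A => (Q \subset A)%:R) = p ^+ #|Q|.
  by rewrite -rset_PrE rset_Pr_subset.
have E_zz : rset_E p (fun A => z A S * z A S') =
    1 - 2 * s * p ^+ 2 + s ^+ 2 * p ^+ #|S :|: S'|.
  transitivity (rset_E p (fun A : {set X} => 1 + (- s * (S \subset A)%:R +
      (- s * (S' \subset A)%:R + s ^+ 2 * ((S :|: S') \subset A)%:R)))).
    apply: eq_rset_E => A; rewrite /z subUset.
    by case: (S \subset A); case: (S' \subset A) => /=; ring.
  by rewrite !rset_ED !rset_EZ rset_E_cst !E_subset S2 S'2; ring.
have z0 A Q : 0 <= z A Q by rewrite /z; case: (_ \subset _) => /=; lra.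
have deficient_le (Q : {set X}) G : #|Q| = 2%N -> deficient Q G ->
    1 - s <= \prod_y z (column G y) Q.
  move=> Q2; rewrite /deficient Lambda2_pair// Q2.
  pose L := [set y | Q \subset column G y]; rewrite -/L.
  have -> : \prod_y z (column G y) Q = (1 - s) ^+ #|L|.
    rewrite -prodr_const [RHS]big_mkcond; apply: eq_bigr => y _.
    by rewrite inE /z; case: ifP => _ /=; ring.
  by case: #|L| => [|[|]]// _; lra.
rewrite -E_zz -prodr_const -(rset_E_columns_prod p (fun _ A => z A S * z A S')).
rewrite rset_PrE -rset_EZ; apply: rset_E_le => // G; rewrite big_split /=.
case: (boolP (deficient S G && deficient S' G)) => [/andP[dS dS']|_] /=.
  by rewrite mulr1 expr2; apply: ler_pM; rewrite ?subr_ge0 ?deficient_le.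
by rewrite mulr0 mulr_ge0 ?prodr_ge0.
Qed.

Lemma deficient_indep p S (s : seq {set X}) :
  all (fun S' : {set X} => [disjoint S & S']) s ->
  rset_Pr p (fun G => deficient S G && none_of deficient s G) =
  rset_Pr p (deficient S) * rset_Pr p (none_of deficient s).
Proof.
move=> sS; rewrite !rset_PrE -(@rset_E_indep _ _ p [set xy | xy.1 \in S]).
- by apply: eq_rset_E => G; rewrite -natrM mulnb.
- by move=> G; rewrite /deficient Lambda2_setI.
- move=> G; congr (nat_of_bool _)%:R; apply: eq_in_all => S' /(allP sS) dSS'.
  have -> : G :\: [set xy | xy.1 \in S] = G :&: [set xy | xy.1 \in ~: S].
    by apply/setP => xy; rewrite !inE andbC.
  by rewrite /deficient Lambda2_setI// -disjoints_subset disjoint_sym.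
Qed.

End RandomBigraph.

Section DoubleHall.
Variables (R : realFieldType) (X Y : finType).
Implicit Types (p s : R) (G : bigraph X Y) (S : {set X}).

Definition pairs : seq {set X} := enum [set S : {set X} | #|S| == 2%N].

Lemma mem_pairs S : (S \in pairs) = (#|S| == 2%N).
Proof. by rewrite mem_enum inE. Qed.

Lemma size_pairs : size pairs = 'C(#|X|, 2).
Proof. by rewrite -cardE card_draws. Qed.

Lemma card_pairs_meeting_le S :
  (#|[set S' : {set X} | (#|S'| == 2) && ~~ [disjoint S & S']]| <=
   #|S| * #|X|)%N.
Proof.
rewrite -cardsT -cardsX.
apply: leq_trans (leq_imset_card (fun xy : X * X => [set xy.1; xy.2]) _).
apply: subset_leq_card; apply/subsetP => S'.
rewrite inE => /andP[/cards2P[x [y [_ ->]]]].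
rewrite -setI_eq0 => /set0Pn[z]; rewrite !inE => /andP[zS].
case/orP=> [/eqP zx|/eqP zy].
  by apply/imsetP; exists (x, y); rewrite //= !inE -zx zS.
by apply/imsetP; exists (y, x); [rewrite !inE -zy zS|exact: setUC].
Qed.

Lemma cardsU_meeting_pairs (S S' : {set X}) : #|S| = 2%N -> #|S'| = 2%N ->
  ~~ [disjoint S & S'] -> S' != S -> #|S :|: S'| = 3%N.
Proof.
move=> S2 S'2; rewrite -setI_eq0 -cards_eq0 -lt0n => I0 S'S.
rewrite cardsU S2 S'2; suff -> : #|S :&: S'| = 1%N by [].
apply/eqP; rewrite eqn_leq I0 andbT -ltnS -S2 ltn_neqAle.
rewrite subset_leq_card ?subsetIl// andbT; apply: contra S'S => /eqP SI.
rewrite eq_sym eqEcard S2 S'2 leqnn andbT; apply/setIidPl/eqP.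
by rewrite eqEcard subsetIl SI leqnn.
Qed.

Lemma sum_meeting_pairs_le (e : R) : 0 <= e ->
  \sum_(S <- pairs) \sum_(S' <- pairs | ~~ [disjoint S & S'] && (S' != S)) e <=
  #|X|%:R ^+ 3 * e.
Proof.
move=> e0; apply: (@le_trans _ _ (\sum_(S <- pairs) (2 * #|X|)%:R * e)).
  rewrite big_seq [leRHS]big_seq; apply: ler_sum => S.
  rewrite mem_pairs => /eqP S2.
  rewrite big_const_seq iter_addr_0 -[e *+ _]mulr_natl ler_wpM2r// ler_nat.
  rewrite -S2; apply: leq_trans (card_pairs_meeting_le S).
  rewrite -size_filter -(card_uniqP (filter_uniq _ (enum_uniq _))).
  apply: subset_leq_card; apply/subsetP => S'.
  by rewrite mem_filter mem_pairs inE => /andP[/andP[-> _] ->].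
rewrite big_const_seq iter_addr_0 count_predT size_pairs.
rewrite -[_ * e *+ _]mulr_natl mulrA ler_wpM2r// -natrM -natrX ler_nat mulnA.
rewrite -[2%N]/(2`!) bin_ffact ffactnSr ffactn1.
by rewrite -[3%N]/(1 + 1 + 1)%N !expnD !expn1 !leq_mul ?leq_subr.
Qed.

Definition deficient_pairs_bound (m : nat) s p : R :=
  (1 - s) ^- 2 * (1 - 2 * s * p ^+ 2 + s ^+ 2 * p ^+ 3) ^+ m.

Lemma deficient_pairs_base_ge0 s p : 0 <= p <= 1 ->
  0 <= 1 - 2 * s * p ^+ 2 + s ^+ 2 * p ^+ 3.
Proof.
move=> /andP[p0 p1].
have -> : 1 - 2 * s * p ^+ 2 + s ^+ 2 * p ^+ 3 = (1 - p) + p * (1 - s * p) ^+ 2.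
  by ring.
by apply: addr_ge0; [rewrite subr_ge0|rewrite mulr_ge0 ?sqr_ge0].
Qed.

Lemma deficient_pairs_bound_ge0 m s p : 0 <= p <= 1 ->
  0 <= deficient_pairs_bound m s p.
Proof.
move=> p01; rewrite mulr_ge0 ?invr_ge0 ?sqr_ge0// exprn_ge0//.
exact: deficient_pairs_base_ge0.
Qed.

Definition no_deficient_pair : pred (bigraph X Y) :=
  none_of (@deficient X Y) pairs.

Lemma no_deficient_pair_approx p s : 0 <= p <= 1 -> 0 <= s < 1 ->
  `|rset_Pr p no_deficient_pair -
    (1 - deficient_pair_prob #|Y| p) ^+ 'C(#|X|, 2)| <=
  #|X|%:R ^+ 3 *
    (deficient_pairs_bound #|Y| s p + deficient_pair_prob #|Y| p ^+ 2).
Proof.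
move=> p01 /andP[s0 s1].
have Pr_pair S : S \in pairs ->
    rset_Pr p (@deficient X Y S) = deficient_pair_prob #|Y| p.
  by rewrite mem_pairs => /eqP; exact: rset_Pr_deficient_pair.
have prodE : \prod_(S <- pairs) (1 - rset_Pr p (@deficient X Y S)) =
    (1 - deficient_pair_prob #|Y| p) ^+ 'C(#|X|, 2).
  rewrite (eq_big_seq (fun=> 1 - deficient_pair_prob #|Y| p)).
    by rewrite big_const_seq count_predT size_pairs iter_mulr_1.
  by move=> S /Pr_pair->.
pose meet S S' := ~~ [disjoint S & S'].
rewrite -prodE.
apply: le_trans (rset_Pr_none_of_approx (dep := meet) p01 _ (enum_uniq _)) _.
  by move=> S r; rewrite (eq_all (fun=> negbK _)); exact: deficient_indep.
apply: le_trans (sum_meeting_pairs_le _); last first.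
  by rewrite addr_ge0 ?sqr_ge0 ?deficient_pairs_bound_ge0.
rewrite big_seq [leRHS]big_seq; apply: ler_sum => S Sp.
rewrite big_seq_cond [leRHS]big_seq_cond.
apply: ler_sum => S' /andP[S'p /andP[SS' nSS']].
rewrite !Pr_pair//; apply: lerD; last by rewrite expr2.
move: Sp S'p; rewrite !mem_pairs => /eqP S2 /eqP S'2.
rewrite ler_pdivlMl ?exprn_gt0//; last lra.
rewrite -(cardsU_meeting_pairs S2 S'2 SS' nSS').
apply: rset_Pr_deficient2_le => //.
by rewrite s0 ltW.
Qed.

Definition deficient_bound (n m k : nat) p : R :=
  'C(n, k)%:R * ('C(m, k.-1)%:R * card_le1_prob k p ^+ (m - k.-1)).

Lemma rset_Pr_deficient_card_le p k : 0 <= p <= 1 -> (0 < k <= #|Y|.+1)%N ->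
  rset_Pr p (fun G : bigraph X Y =>
    [exists S : {set X}, (#|S| == k) && deficient S G]) <=
  deficient_bound #|X| #|Y| k p.
Proof.
move=> p01 /andP[k0 kY].
apply: (@le_trans _ _
  (\sum_(S : {set X} | #|S| == k) rset_Pr p (@deficient X Y S))).
  apply: rset_Pr_le_sum => // G /existsP[S dS].
  by apply/hasP; exists S; rewrite ?mem_index_enum.
apply: (@le_trans _ _ (\sum_(S in [set S : {set X} | #|S| == k])
    'C(#|Y|, k.-1)%:R * card_le1_prob k p ^+ (#|Y| - k.-1))).
  under [leRHS]eq_bigl do rewrite inE.
  apply: ler_sum => S /eqP Sk.
  by have := @rset_Pr_deficient_le _ X Y p S p01; rewrite Sk; apply.
by rewrite sumr_const card_draws -[leLHS]mulr_natl.
Qed.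

Lemma rset_Pr_double_Hall_le p : (2 <= #|X|)%N -> 0 <= p <= 1 ->
  rset_Pr p (@double_Hall X Y) <= rset_Pr p no_deficient_pair.
Proof.
move=> X2 p01; apply: rset_Pr_sub => // G.
rewrite double_HallE// => /forallP dH.
by apply/allP => S; rewrite mem_pairs => /eqP S2; have := dH S; rewrite S2.
Qed.

Lemma rset_Pr_no_deficient_pair_le p : (2 <= #|X| <= #|Y|)%N -> 0 <= p <= 1 ->
  rset_Pr p no_deficient_pair <= rset_Pr p (@double_Hall X Y) +
    \sum_(3 <= k < #|X|.+1) deficient_bound #|X| #|Y| k p.
Proof.
move=> /andP[X2 XY] p01.
pose some_of_size k (G : bigraph X Y) :=
  [exists S : {set X}, (#|S| == k) && deficient S G].
pose some_large G := has (some_of_size^~ G) (index_iota 3 #|X|.+1).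
apply: (@le_trans _ _ (rset_Pr p (@double_Hall X Y) + rset_Pr p some_large)).
  apply: rset_Pr_le_add => // G /allP no_pairG.
  apply/orP; have [|dH] := boolP (double_Hall G); [by left|right].
  move: dH; rewrite double_HallE// negb_forall => /existsP[S].
  rewrite negb_imply negbK => /andP[S2 dS].
  apply/hasP; exists #|S|; last by apply/existsP; exists S; rewrite eqxx.
  rewrite mem_index_iota ltnS max_card andbT ltn_neqAle S2 andbT.
  by apply: contraL dS => S2'; apply: no_pairG; rewrite mem_pairs eq_sym.
rewrite lerD2l; apply: (@le_trans _ _
  (\sum_(3 <= k < #|X|.+1) rset_Pr p (some_of_size k))).
  exact: rset_Pr_le_sum.
rewrite big_nat [leRHS]big_nat; apply: ler_sum => k /andP[k3 kX].
apply: rset_Pr_deficient_card_le => //; rewrite (leq_trans _ k3)//=.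
by rewrite (leq_trans (ltnW kX)).
Qed.

Lemma double_Hall_approx p s : (2 <= #|X| <= #|Y|)%N ->
    0 <= p <= 1 -> 0 <= s < 1 ->
  `|rset_Pr p (@double_Hall X Y) -
    (1 - deficient_pair_prob #|Y| p) ^+ 'C(#|X|, 2)| <=
  #|X|%:R ^+ 3 *
    (deficient_pairs_bound #|Y| s p + deficient_pair_prob #|Y| p ^+ 2) +
  \sum_(3 <= k < #|X|.+1) deficient_bound #|X| #|Y| k p.
Proof.
move=> XY p01 s01; have /andP[X2 _] := XY.
rewrite -(subrK (rset_Pr p no_deficient_pair) (rset_Pr p (@double_Hall X Y))).
rewrite -addrA addrC.
apply: le_trans (ler_normD _ _) (lerD (no_deficient_pair_approx p01 s01) _).
rewrite distrC ger0_norm ?subr_ge0 ?rset_Pr_double_Hall_le//.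
by rewrite lerBlDl rset_Pr_no_deficient_pair_le.
Qed.

Lemma rset_Pr_double_Hall_mono p q : 0 <= p -> p <= q -> q <= 1 ->
  rset_Pr p (@double_Hall X Y) <= rset_Pr q (@double_Hall X Y).
Proof.
by move=> p0 pq q1; apply: rset_Pr_mono => //; exact: double_Hall_homo.
Qed.

End DoubleHall.

Lemma Gnnp_PrE (R : realType) n (p : R) (E : pred (bigraph 'I_n 'I_n)) :
  Gnnp_Pr p E = rset_Pr p E.
Proof. by []. Qed.

(** * Large deficient sets *)

Lemma ffact_le_expn (n k : nat) : (n ^_ k <= n ^ k)%N.
Proof.
elim: k => [|k IH]; first by rewrite ffactn0.
by rewrite ffactnSr expnSr leq_mul// leq_subr.
Qed.

Lemma bin_le_expn (n k : nat) : ('C(n, k) <= n ^ k)%N.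
Proof.
apply: leq_trans (ffact_le_expn n k).
by rewrite -bin_ffact leq_pmulr// fact_gt0.
Qed.

Lemma natr_bin2 (R : numFieldType) k : 'C(k, 2)%:R = k%:R * (k%:R - 1) / 2 :> R.
Proof.
case: k => [|k]; first by rewrite !mul0r.
have := congr1 (fun i => i%:R : R) (mul_bin_diag k.+1 1).
by rewrite /= bin1 !natrM -natr1 addrK => ->; field.
Qed.

Lemma natr_bin3 (R : numFieldType) k :
  'C(k, 3)%:R = k%:R * (k%:R - 1) * (k%:R - 2) / 6 :> R.
Proof.
have [k2|k2] := ltnP k 2.
  rewrite bin_small//; case: k k2 => [|[]]// _; first by rewrite !mul0r.
  by rewrite subrr mulr0 !mul0r.
have := congr1 (fun i => i%:R : R) (mul_bin_left k 2).
rewrite !natrM natrB// natr_bin2 => C3E.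
apply: (@mulfI _ 3); first by rewrite pnatr_eq0.
by rewrite C3E; field.
Qed.

Section ElementaryBounds.
Variable R : realType.
Implicit Types (x p : R).

Lemma expR_ln_nat (n : nat) : (0 < n)%N -> expR (ln n%:R) = n%:R :> R.
Proof. by move=> n0; rewrite lnK// posrE ltr0n. Qed.

Lemma bin_le_expR (n k j : nat) : (0 < n)%N -> (k <= n)%N ->
    (minn k (n - k) <= j)%N ->
  'C(n, k)%:R <= expR (j%:R * ln n%:R) :> R.
Proof.
move=> n0 kn kj; rewrite expRM_natl expR_ln_nat// -natrX ler_nat.
apply: leq_trans (leq_pexp2l n0 kj).
by case: (leqP k (n - k)) => _; [|rewrite -bin_sub//]; exact: bin_le_expn.
Qed.

Lemma onem_expn_le_expR m p : p <= 1 -> (1 - p) ^+ m <= expR (- (m%:R * p)).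
Proof.
move=> p1; rewrite -mulrN expRM_natl lerXn2r ?nnegrE ?expR_ge0 ?subr_ge0//.
exact: expR_ge1Dx.
Qed.

Lemma expRN_le_onem x : x < 1 -> expR (- (x / (1 - x))) <= 1 - x.
Proof.
move=> x1; have x10 : 0 < 1 - x by rewrite subr_gt0.
rewrite expRN -[leRHS]invrK lef_pV2 ?posrE ?expR_gt0 ?invr_gt0//.
apply: le_trans (expR_ge1Dx _); rewrite le_eqVlt; apply/orP; left; apply/eqP.
by field; exact: lt0r_neq0.
Qed.

Lemma oneD_le_expR_large x : 1 / 10 <= x -> 1 + x <= expR (x - x / 50).
Proof.
move=> x0; pose y := 49 / 100 * x.
have -> : x - x / 50 = y + y by rewrite /y; field.
apply: (@le_trans _ _ ((1 + y) * (1 + y))).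
  have : 1 / 10 * x <= x * x by rewrite ler_wpM2r//; lra.
  by rewrite /y; lra.
rewrite expRD; have y0 : 0 <= 1 + y by rewrite /y; lra.
by rewrite ler_pM// expR_ge1Dx.
Qed.

End ElementaryBounds.

Section LargeSets.
Variables (R : realType) (n : nat) (p : R).
Implicit Types (k : nat).

Local Notation L := (ln n%:R : R).

(* [p <= 1 / 250] turns [2 L <= n p ^+ 2] into [500 L <= n p], which beats the
   entropy of the choice of large sets. *)
Definition sparse_range : Prop :=
  [/\ 0 < p, p <= 1 / 250, 1 <= L & 2 * L <= n%:R * p ^+ 2].

Hypothesis np : sparse_range.

Lemma sparse_range_p01 : 0 <= p <= 1.
Proof. by have [? ? _ _] := np; apply/andP; split; lra. Qed.

Lemma sparse_range_n_gt0 : (0 < n)%N.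
Proof.
have [_ _ L1 _] := np; rewrite lt0n; apply: contraTneq L1 => ->.
by rewrite ln0//; lra.
Qed.

Lemma sparse_range_np : 500 * L <= n%:R * p.
Proof.
have [p0 p1 _] := np; rewrite expr2 mulrA => npp.
suff : n%:R * p * p <= n%:R * p * (1 / 250) by lra.
by rewrite ler_wpM2l// mulr_ge0// ltW.
Qed.

Lemma deficient_bound_le_expR k (a b h : R) :
    'C(n, k)%:R <= expR a -> 'C(n, k.-1)%:R <= expR b ->
    card_le1_prob k p <= expR (- h) ->
  deficient_bound n n k p <= expR (a + b - (n - k.-1)%:R * h).
Proof.
move=> Ca Cb qh; have /andP[q0 _] := card_le1_prob_itv k sparse_range_p01.
rewrite -addrA !expRD -mulrN expRM_natl.
rewrite /deficient_bound ler_pM ?mulr_ge0 ?exprn_ge0//.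
by rewrite ler_pM ?exprn_ge0// lerXn2r ?nnegrE ?expR_ge0.
Qed.

(* The binomial coefficients contribute at most [n ^ (2 k - 1)], while a vertex
   has two neighbours in a given [k]-set with probability about [C(k, 2) p ^ 2];
   the factor [11 / 12] absorbs the error terms. *)
Lemma deficient_bound_small k : (3 <= k <= n)%N -> k.-1%:R * p <= 1 / 10 ->
  deficient_bound n n k p <=
  expR (- ((11 / 12 * (k%:R * (k%:R - 1)) - (2 * k%:R - 1)) * L)).
Proof.
move=> /andP[k3 kn] kp; have [p0 p1 L1 npp] := np; have npL := sparse_range_np.
have n0 := sparse_range_n_gt0; have k0 : (0 < k)%N by apply: leq_trans k3.
have kk0 : 0 <= k%:R * (k%:R - 1) :> R.
  by rewrite mulr_ge0// subr_ge0 (ler_nat _ 1).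
have k1E : k.-1%:R = k%:R - 1 :> R by rewrite -subn1 natrB.
rewrite k1E in kp; pose h := 7 / 15 * (k%:R * (k%:R - 1)) * p ^+ 2.
have qh : card_le1_prob k p <= expR (- h).
  apply: le_trans (card_le1_prob_le k sparse_range_p01) _.
  apply: le_trans (expR_ge1Dx (- h)).
  have : k%:R * (k%:R - 1) * p ^+ 2 * ((k%:R - 2) * p) <=
      k%:R * (k%:R - 1) * p ^+ 2 * (1 / 10).
    by apply: ler_wpM2l; [apply: mulr_ge0 kk0 (sqr_ge0 p)|lra].
  rewrite natr_bin2 natr_bin3 /h; lra.
apply: le_trans
  (deficient_bound_le_expR (a := k%:R * L) (b := k.-1%:R * L) _ _ qh) _.
- by apply: bin_le_expR => //; rewrite geq_minl.
- by apply: bin_le_expR => //; rewrite ?geq_minl// (leq_trans (leq_pred _)).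
rewrite ler_expR natrB ?(leq_trans (leq_pred _))// k1E.
have kn100 : k%:R - 1 <= n%:R / 100 :> R.
  by rewrite -(ler_pM2r p0); lra.
have npp' : 99 / 100 * (2 * L) <= (n%:R - (k%:R - 1)) * p ^+ 2.
  have := ler_wpM2r (sqr_ge0 p) kn100; lra.
have := ler_wpM2l kk0 npp'; rewrite /h.
have : 0 <= k%:R * (k%:R - 1) * L by rewrite mulr_ge0//; lra.
lra.
Qed.

(* With [j := min (k - 1) (n - k + 1)], the binomial coefficients contribute at
   most [n ^ (2 j + 1)], and [(n - k + 1) (k - 1)] is at least [j n / 2]. *)
Lemma deficient_bound_large k : (1 < k <= n)%N -> 1 / 10 <= k.-1%:R * p ->
  deficient_bound n n k p <= expR (- (2 * L)).
Proof.
case: k => // m /andP[]; rewrite ltnS => m0 mn /= mp; have [p0 p1 L1 npp] := np.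
have npL := sparse_range_np; have n0 := sparse_range_n_gt0.
pose j := minn m (n - m).
have j1 : 1 <= j%:R :> R by rewrite (ler_nat _ 1) leq_min m0 subn_gt0.
have jn : n%:R * j%:R <= 2 * ((n - m)%:R * m%:R) :> R.
  rewrite -!natrM ler_nat -{1}(subnK (ltnW mn)) mulnDl mul2n -addnn /j.
  case: (leqP m (n - m)) => [mt|/ltnW tm].
    by rewrite leq_add2l leq_mul2r mt orbT.
  by rewrite [(m * _)%N]mulnC leq_add2r leq_mul2l tm orbT.
pose h := m%:R * p / 50.
have qh : card_le1_prob m.+1 p <= expR (- h).
  have -> : - h = - (m%:R * p) + (m%:R * p - h) by ring.
  have /andP[_ p1'] := sparse_range_p01.
  have p10 : 0 <= 1 - p by rewrite subr_ge0.
  rewrite expRD ler_pM ?exprn_ge0 ?onem_expn_le_expR ?oneD_le_expR_large//=.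
  lra.
apply: le_trans
  (deficient_bound_le_expR (a := j.+1%:R * L) (b := j%:R * L) _ _ qh) _.
- apply: bin_le_expR => //.
  rewrite -minnSS leq_min geq_minl (leq_trans (geq_minr _ _))//.
  by rewrite leqW ?leq_sub2l.
- by apply: bin_le_expR => //; rewrite ltnW.
rewrite ler_expR -natr1 /h.
have : 500 * L * j%:R <= n%:R * p * j%:R by rewrite ler_wpM2r.
have : n%:R * j%:R * p <= 2 * ((n - m)%:R * m%:R) * p by rewrite ler_pM2r.
have : L <= L * j%:R by rewrite ler_peMr//; lra.
lra.
Qed.

Lemma sum_deficient_bound :
  \sum_(3 <= k < n.+1) deficient_bound n n k p <= 2 * expR (- (1 / 2 * L)).
Proof.
have [_ _ L1 _] := np; have n0 := sparse_range_n_gt0.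
have bound_le k a : (3 <= k <= n)%N -> a <= 2 ->
    a <= 11 / 12 * (k%:R * (k%:R - 1)) - (2 * k%:R - 1) ->
    deficient_bound n n k p <= expR (- (a * L)).
  move=> /andP[k3 kn] a2 ak; have [kp|kp] := leP (k.-1%:R * p) (1 / 10).
    apply: le_trans (deficient_bound_small _ kp) _; first by rewrite k3.
    by rewrite ler_expR lerN2 ler_wpM2r//; lra.
  apply: le_trans (deficient_bound_large _ (ltW kp)) _.
    by rewrite (ltnW k3).
  by rewrite ler_expR lerN2 ler_wpM2r//; lra.
have [n2|n3] := ltnP n 3.
  by rewrite big_geq// mulr_ge0// expR_ge0.
rewrite big_ltn// mulrDl mul1r; apply: lerD.
  by apply: bound_le => //; lra.
apply: (@le_trans _ _ (\sum_(4 <= k < n.+1) expR (- (2 * L)))).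
  rewrite big_nat [leRHS]big_nat; apply: ler_sum => k /andP[k4 kn].
  apply: bound_le; rewrite ?(ltnW k4)//.
  have : 4 <= k%:R :> R by rewrite (ler_nat _ 4).
  nra.
rewrite sumr_const_nat -[_ *+ _]mulr_natl.
apply: (@le_trans _ _ (n%:R * expR (- (2 * L)))).
  by rewrite ler_wpM2r ?expR_ge0// ler_nat leq_subLR addSn ltnS leq_addl.
by rewrite -{1}(expR_ln_nat R n0) -expRD ler_expR; lra.
Qed.

End LargeSets.

(** * Asymptotics *)

Local Open Scope classical_set_scope.
Local Open Scope ring_scope.

Section Limits.
Variable R : realType.
Implicit Types (b : nat -> R) (a l : R).

Lemma cvgy_invr0 {T : Type} {F : set_system T} {FF : Filter F} (f : T -> R) :
  f x @[x --> F] --> +oo -> (f x)^-1 @[x --> F] --> 0.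
Proof.
by move=> fy; apply/(@gtr0_cvgV0 R T F FF f) => //; exact: cvgry_gt.
Qed.

Lemma cvgry_ln : ln x @[x --> (+oo : set_system R)] --> +oo.
Proof.
apply/cvgryPge => A; near=> x.
have Ax : expR A <= x by near: x; exact: nbhs_pinfty_ge.
by rewrite -[A]expRK ler_ln ?posrE ?expR_gt0// (lt_le_trans (expR_gt0 A)).
Unshelve. all: by end_near. Qed.

Lemma cvgr_lnXn_div k : ln x ^+ k / x @[x --> (+oo : set_system R)] --> 0.
Proof.
have lnV_cvg0 : k.+1`!%:R * (ln x)^-1 @[x --> (+oo : set_system R)] --> 0.
  rewrite -[X in _ --> X](mulr0 k.+1`!%:R).
  exact: cvgMl_tmp (cvgy_invr0 cvgry_ln).
apply: squeeze_cvgr (cvg_cst _) lnV_cvg0; near=> x.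
have x0 : 0 < x by near: x; exact: nbhs_pinfty_gt.
have lnx0 : 0 < ln x by near: x; exact: cvgry_gt cvgry_ln _.
apply/andP; split; first by rewrite divr_ge0 ?exprn_ge0 ?ltW.
rewrite ler_pdivrMr// mulrAC ler_pdivlMr// -exprSr mulrC.
rewrite -ler_pdivrMr ?ltr0n ?fact_gt0// -[leRHS]lnK//.
by apply: le_trans (expR_ge1Dxn k (ltW lnx0)); rewrite lerDr.
Unshelve. all: by end_near. Qed.

Lemma cvgr_expRNM a : 0 < a ->
  expR (- (a * x)) @[x --> (+oo : set_system R)] --> 0.
Proof.
by move=> a0; apply: cvg_comp _ _ (gt0_cvgMry a0 (@cvg_id _ _)) (@cvgr_expR R).
Qed.

Lemma ln_nat_cvgy : (ln n%:R : R) @[n --> \oo] --> +oo.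
Proof. exact: cvg_comp _ _ (@cvgr_idn R) cvgry_ln. Qed.

Lemma ln_ln_nat_cvgy : ln (ln n%:R : R) @[n --> \oo] --> +oo.
Proof. exact: cvg_comp _ _ ln_nat_cvgy cvgry_ln. Qed.

Lemma invr_nat_cvg0 : n%:R^-1 @[n --> \oo] --> (0 : R).
Proof. exact: cvgy_invr0 cvgr_idn. Qed.

Lemma ln_nat_gt0 : \forall n \near \oo, 0 < ln n%:R :> R.
Proof. exact: cvgry_gt ln_nat_cvgy _. Qed.

Lemma cvg_onem_expn_expR b (N : nat -> nat) :
  b n @[n --> \oo] --> 0 -> (N n)%:R * b n ^+ 2 @[n --> \oo] --> 0 ->
  (1 - b n) ^+ N n * expR ((N n)%:R * b n) @[n --> \oo] --> (1 : R).
Proof.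
move=> b0 Nb2.
have inv_cvg : (1 - b n)^-1 @[n --> \oo] --> (1 - 0 : R)^-1.
  apply: (@cvgV _ _ _ _ (fun n => 1 - b n)); first by rewrite subr0 oner_neq0.
  exact: cvgB (cvg_cst _) b0.
have lower_cvg :
    expR (- ((N n)%:R * b n ^+ 2 / (1 - b n))) @[n --> \oo] --> (1 : R).
  rewrite -[X in _ --> X]expR0 -[X in expR X]oppr0.
  rewrite -[X in - X](mul0r (1 - 0)^-1).
  apply: continuous_cvg; first exact: continuous_expR.
  exact: cvgN (cvgM Nb2 inv_cvg).
apply: squeeze_cvgr lower_cvg (cvg_cst _); near=> n.
have b1 : b n < 1 by near: n; exact: cvgr_lt b0 _ ltr01.
apply/andP; split; last first.
  rewrite -[leRHS](expRxMexpNx_1 (- ((N n)%:R * b n))) opprK.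
  by rewrite ler_wpM2r ?expR_ge0// onem_expn_le_expR// ltW.
have -> : - ((N n)%:R * b n ^+ 2 / (1 - b n)) =
    (N n)%:R * - (b n / (1 - b n)) + (N n)%:R * b n.
  by field; rewrite lt0r_neq0// subr_gt0.
rewrite expRD ler_wpM2r ?expR_ge0// expRM_natl.
apply: lerXn2r; rewrite ?nnegrE ?expR_ge0 ?subr_ge0 ?(ltW b1)//.
exact: expRN_le_onem.
Unshelve. all: by end_near. Qed.

Lemma cvg_onem_expn b (N : nat -> nat) l :
  b n @[n --> \oo] --> 0 -> (N n)%:R * b n @[n --> \oo] --> l ->
  (1 - b n) ^+ N n @[n --> \oo] --> expR (- l).
Proof.
move=> b0 Nb.
have Nb2 : (N n)%:R * b n ^+ 2 @[n --> \oo] --> 0.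
  rewrite -(mulr0 l); under eq_fun do rewrite expr2 mulrA; exact: cvgM.
have expNb : expR (- ((N n)%:R * b n)) @[n --> \oo] --> expR (- l).
  by apply: continuous_cvg; [exact: continuous_expR|exact: cvgN].
have powE n : (1 - b n) ^+ N n =
    (1 - b n) ^+ N n * expR ((N n)%:R * b n) * expR (- ((N n)%:R * b n)).
  by rewrite -mulrA expRxMexpNx_1 mulr1.
rewrite -(mul1r (expR (- l))); under eq_fun do rewrite powE.
exact: cvgM (cvg_onem_expn_expR b0 Nb2) expNb.
Qed.

End Limits.

(* The expected number of common neighbours of two vertices of X. *)
Definition codegree (R : realType) (c : nat -> R) (n : nat) : R :=
  2 * ln n%:R + ln (ln n%:R) + c n.

Section CriticalWindow.
Variables (R : realType) (c : nat -> R) (c0 : R).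
Hypothesis c_cvg : c n @[n --> \oo] --> c0.

Local Notation L n := (ln n%:R : R).
Local Notation p := (edge_prob c).
Local Notation nu := (codegree c).

Lemma codegree_ge : \forall n \near \oo, 2 * L n <= nu n.
Proof.
near=> n; have lnln_ge : 1 - c0 <= ln (L n).
  by near: n; exact: cvgry_ge (@ln_ln_nat_cvgy R) _.
have : c0 - 1 <= c n by near: n; apply: cvgr_ge c_cvg _ _; lra.
rewrite /codegree; lra.
Unshelve. all: by end_near. Qed.

Lemma codegree_div_ln_cvg : nu n / L n @[n --> \oo] --> (2 : R).
Proof.
have lnln_cvg : ln (L n) ^+ 1 / L n @[n --> \oo] --> (0 : R).
  exact: cvg_comp _ _ (@ln_nat_cvgy R) (cvgr_lnXn_div 1).
have c_cvg0 : c n / L n @[n --> \oo] --> c0 * 0.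
  exact: cvgM c_cvg (cvgy_invr0 (@ln_nat_cvgy R)).
have : 2 + ln (L n) ^+ 1 / L n + c n / L n @[n --> \oo] --> 2 + 0 + c0 * 0.
  exact: cvgD (cvgD (cvg_cst _) lnln_cvg) c_cvg0.
rewrite addr0 mulr0 addr0; apply: cvg_trans; apply: near_eq_cvg; near=> n.
have L0 : 0 < L n by near: n; exact: ln_nat_gt0.
by rewrite /codegree /=; field; rewrite lt0r_neq0.
Unshelve. all: by end_near. Qed.

Lemma codegreeX_div_cvg0 k : nu n ^+ k / n%:R @[n --> \oo] --> (0 : R).
Proof.
have LX_cvg0 : L n ^+ k / n%:R @[n --> \oo] --> (0 : R).
  exact: cvg_comp _ _ (@cvgr_idn R) (cvgr_lnXn_div k).
have nuX_cvg : (nu n / L n) ^+ k @[n --> \oo] --> (2 ^+ k : R).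
  exact: (continuous_cvg _ (@exprn_continuous R k _) codegree_div_ln_cvg).
have : (nu n / L n) ^+ k * (L n ^+ k / n%:R) @[n --> \oo] --> (2 ^+ k * 0 : R).
  exact: cvgM.
rewrite mulr0; apply: cvg_trans; apply: near_eq_cvg; near=> n.
have L0 : 0 < L n by near: n; exact: ln_nat_gt0.
by rewrite /= expr_div_n mulrA divfK// expf_neq0// lt0r_neq0.
Unshelve. all: by end_near. Qed.

Lemma sqr_edge_prob : \forall n \near \oo, p n ^+ 2 = nu n / n%:R.
Proof.
near=> n; rewrite sqr_sqrtr// divr_ge0// -/(nu n).
have : 2 * L n <= nu n by near: n; exact: codegree_ge.
have : 0 < L n by near: n; exact: ln_nat_gt0.
lra.
Unshelve. all: by end_near. Qed.

Lemma natr_mul_sqr_edge_prob : \forall n \near \oo, n%:R * p n ^+ 2 = nu n.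
Proof.
near=> n; have -> : p n ^+ 2 = nu n / n%:R by near: n; exact: sqr_edge_prob.
have n0 : (0 < n)%N by near: n; exact: nbhs_infty_gt.
by rewrite mulrC divfK// pnatr_eq0 -lt0n.
Unshelve. all: by end_near. Qed.

Lemma edge_prob_cvg0 : p n @[n --> \oo] --> (0 : R).
Proof.
rewrite -(sqrtr0 R).
exact: (continuous_cvg _ (@sqrt_continuous R _) (codegreeX_div_cvg0 1)).
Qed.

Lemma sqr_edge_prob_cvg0 : p n ^+ 2 @[n --> \oo] --> (0 : R).
Proof.
rewrite -[X in _ --> X](mulr0 0); exact: cvgM edge_prob_cvg0 edge_prob_cvg0.
Qed.

Lemma edge_prob_sparse : \forall n \near \oo, sparse_range n (p n).
Proof.
near=> n; have L1 : 1 <= L n by near: n; exact: cvgry_ge (@ln_nat_cvgy R) _.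
have np2 : 2 * L n <= n%:R * p n ^+ 2.
  have -> : n%:R * p n ^+ 2 = nu n by near: n; exact: natr_mul_sqr_edge_prob.
  by near: n; exact: codegree_ge.
split=> //; last by near: n; apply: cvgr_le edge_prob_cvg0 _ _; lra.
rewrite lt_neqAle sqrtr_ge0 andbT; apply: contraTneq np2 => <-.
by rewrite expr0n mulr0 -ltNge; lra.
Unshelve. all: by end_near. Qed.

Lemma expR_codegree :
  \forall n \near \oo, expR (nu n) = n%:R ^+ 2 * L n * expR (c n).
Proof.
near=> n; have n0 : (0 < n)%N by near: n; exact: nbhs_infty_gt.
have L0 : 0 < L n by near: n; exact: ln_nat_gt0.
by rewrite !expRD expRM_natl (expR_ln_nat R n0) lnK.
Unshelve. all: by end_near. Qed.

Lemma pred_mul_sqr_edge_prob :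
  \forall n \near \oo, n.-1%:R * p n ^+ 2 = nu n - p n ^+ 2.
Proof.
near=> n; have n0 : (0 < n)%N by near: n; exact: nbhs_infty_gt.
rewrite -subn1 natrB// mulrBl mul1r; congr (_ - _).
by near: n; exact: natr_mul_sqr_edge_prob.
Unshelve. all: by end_near. Qed.

Lemma pred_mul_edge_prob_pow4_cvg0 :
  n.-1%:R * (p n ^+ 2) ^+ 2 @[n --> \oo] --> (0 : R).
Proof.
have : nu n ^+ 2 / n%:R - p n ^+ 2 * p n ^+ 2 @[n --> \oo] --> (0 - 0 * 0 : R).
  apply: cvgB (codegreeX_div_cvg0 2) _.
  exact: cvgM sqr_edge_prob_cvg0 sqr_edge_prob_cvg0.
rewrite mulr0 subr0; apply: cvg_trans; apply: near_eq_cvg; near=> n.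
have rE : p n ^+ 2 = nu n / n%:R by near: n; exact: sqr_edge_prob.
have n1rE : n.-1%:R * p n ^+ 2 = nu n - p n ^+ 2.
  by near: n; exact: pred_mul_sqr_edge_prob.
rewrite [RHS]mulrA n1rE mulrBl [in X in _ = X - _]rE.
by congr (_ - _); rewrite mulrA.
Unshelve. all: by end_near. Qed.

Lemma onem_sqr_edge_prob_expn_cvg :
  (1 - p n ^+ 2) ^+ n.-1 * expR (nu n) @[n --> \oo] --> (1 : R).
Proof.
have expr_cvg : expR (p n ^+ 2) @[n --> \oo] --> (1 : R).
  rewrite -[X in _ --> X]expR0.
  exact: (continuous_cvg _ (@continuous_expR R _) sqr_edge_prob_cvg0).
rewrite -[X in _ --> X]mulr1.
apply: cvg_trans (cvgM (cvg_onem_expn_expR sqr_edge_prob_cvg0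
  pred_mul_edge_prob_pow4_cvg0) expr_cvg).
apply: near_eq_cvg; near=> n.
rewrite /= -mulrA -expRD (_ : n.-1%:R * _ = nu n - p n ^+ 2) ?subrK//.
by near: n; exact: pred_mul_sqr_edge_prob.
Unshelve. all: by end_near. Qed.

Lemma deficient_pair_prob_cvg :
  n%:R ^+ 2 * deficient_pair_prob n (p n) @[n --> \oo] --> 2 * expR (- c0).
Proof.
pose r n := p n ^+ 2.
have mean_cvg : (1 - r n) / L n + nu n / L n @[n --> \oo] --> (2 : R).
  rewrite -[X in _ --> X]add0r -[X in X + _](mulr0 (1 - 0)).
  apply: cvgD codegree_div_ln_cvg.
  exact: cvgM (cvgB (cvg_cst _) sqr_edge_prob_cvg0)
    (cvgy_invr0 (@ln_nat_cvgy R)).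
have expc_cvg : expR (- c n) @[n --> \oo] --> expR (- c0).
  by apply: continuous_cvg; [exact: continuous_expR|exact: cvgN].
have : (1 - r n) ^+ n.-1 * expR (nu n) * ((1 - r n) / L n + nu n / L n) *
    expR (- c n) @[n --> \oo] --> 1 * 2 * expR (- c0).
  exact: cvgM (cvgM onem_sqr_edge_prob_expn_cvg mean_cvg) expc_cvg.
rewrite mul1r; apply: cvg_trans; apply: near_eq_cvg; near=> n.
have L0 : 0 < L n by near: n; exact: ln_nat_gt0.
have nuE : expR (nu n) = n%:R ^+ 2 * L n * expR (c n).
  by near: n; exact: expR_codegree.
have n1rE : n.-1%:R * r n = nu n - r n.
  by near: n; exact: pred_mul_sqr_edge_prob.
rewrite /deficient_pair_prob /card_le1_prob -/(r n) n1rE nuE expRN; field.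
by rewrite lt0r_neq0 ?lt0r_neq0 ?expR_gt0.
Unshelve. all: by end_near. Qed.

Lemma bin2_deficient_pair_prob_cvg :
  'C(n, 2)%:R * deficient_pair_prob n (p n) @[n --> \oo] --> expR (- c0).
Proof.
have half_cvg : (1 - n%:R^-1) / 2 @[n --> \oo] --> (2^-1 : R).
  rewrite -[X in _ --> X]mul1r -[X in X * _](subr0 1); apply: cvgMr_tmp.
  exact: cvgB (cvg_cst _) (@invr_nat_cvg0 R).
have : (1 - n%:R^-1) / 2 * (n%:R ^+ 2 * deficient_pair_prob n (p n))
    @[n --> \oo] --> 2^-1 * (2 * expR (- c0)).
  exact: cvgM half_cvg deficient_pair_prob_cvg.
rewrite mulKf//.
apply: cvg_trans; apply: near_eq_cvg; near=> n.
have n0 : (0 < n)%N by near: n; exact: nbhs_infty_gt.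
by rewrite natr_bin2 /=; field; rewrite pnatr_eq0 -lt0n.
Unshelve. all: by end_near. Qed.

Lemma deficient_pair_prob_cvg0 :
  deficient_pair_prob n (p n) @[n --> \oo] --> (0 : R).
Proof.
have : n%:R ^+ 2 * deficient_pair_prob n (p n) * (n%:R^-1 * n%:R^-1)
    @[n --> \oo] --> 2 * expR (- c0) * (0 * 0).
  apply: cvgM deficient_pair_prob_cvg _.
  exact: cvgM (@invr_nat_cvg0 R) (@invr_nat_cvg0 R).
rewrite !mulr0; apply: cvg_trans; apply: near_eq_cvg; near=> n.
have n0 : (0 < n)%N by near: n; exact: nbhs_infty_gt.
by rewrite /=; field; rewrite pnatr_eq0 -lt0n.
Unshelve. all: by end_near. Qed.

Lemma cube_sqr_deficient_pair_prob_cvg0 :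
  n%:R ^+ 3 * deficient_pair_prob n (p n) ^+ 2 @[n --> \oo] --> (0 : R).
Proof.
pose f n := n%:R ^+ 2 * deficient_pair_prob n (p n).
have f_cvg : f n @[n --> \oo] --> 2 * expR (- c0) := deficient_pair_prob_cvg.
have : f n * f n * n%:R^-1 @[n --> \oo] -->
    2 * expR (- c0) * (2 * expR (- c0)) * 0.
  exact: cvgM (cvgM f_cvg f_cvg) (@invr_nat_cvg0 R).
rewrite mulr0; apply: cvg_trans; apply: near_eq_cvg; near=> n.
have n0 : (0 < n)%N by near: n; exact: nbhs_infty_gt.
by rewrite /f /=; field; rewrite pnatr_eq0 -lt0n.
Unshelve. all: by end_near. Qed.

(* Any [s > 3 / 4] would do in place of [7 / 8]: the left-hand side is about
   [n ^ 3 * exp (- 2 s n p ^ 2)], which is at most [n ^ (3 - 4 s)]. *)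
Lemma cube_deficient_pairs_bound_cvg0 :
  n%:R ^+ 3 * deficient_pairs_bound n (7 / 8) (p n) @[n --> \oo] --> (0 : R).
Proof.
have quarter0 : 0 < 1 / 4 :> R by lra.
have upper_cvg0 : 64 * expR (- (1 / 4 * L n)) @[n --> \oo] --> (0 : R).
  rewrite -[X in _ --> X](mulr0 64); apply: cvgMl_tmp.
  exact: cvg_comp _ _ (@ln_nat_cvgy R) (cvgr_expRNM quarter0).
apply: squeeze_cvgr (cvg_cst _) upper_cvg0; near=> n.
have np : sparse_range n (p n) by near: n; exact: edge_prob_sparse.
have p01 := sparse_range_p01 np; have n0 := sparse_range_n_gt0 np.
have [p0 p1 L1 npp] := np.
rewrite mulr_ge0 ?exprn_ge0 ?deficient_pairs_bound_ge0//=.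
have -> : deficient_pairs_bound n (7 / 8) (p n) =
    64 * (1 - 2 * (7 / 8) * p n ^+ 2 + (7 / 8) ^+ 2 * p n ^+ 3) ^+ n.
  by rewrite /deficient_pairs_bound; congr (_ * _); field.
rewrite mulrCA ler_wpM2l//.
apply: (@le_trans _ _ (expR (3 * L n) * expR (n%:R * - (13 / 8 * p n ^+ 2)))).
  apply: ler_pM; rewrite ?exprn_ge0 ?deficient_pairs_base_ge0//.
    by rewrite expRM_natl expR_ln_nat.
  rewrite expRM_natl lerXn2r ?nnegrE ?expR_ge0 ?deficient_pairs_base_ge0//.
  apply: le_trans (expR_ge1Dx _).
  have : p n ^+ 3 <= 1 / 250 * p n ^+ 2 by rewrite exprS ler_wpM2r ?sqr_ge0.
  have := sqr_ge0 (p n); lra.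
rewrite -expRD ler_expR; lra.
Unshelve. all: by end_near. Qed.

Lemma sum_deficient_bound_cvg0 :
  \sum_(3 <= k < n.+1) deficient_bound n n k (p n) @[n --> \oo] --> (0 : R).
Proof.
have half0 : 0 < 1 / 2 :> R by lra.
have upper_cvg0 : 2 * expR (- (1 / 2 * L n)) @[n --> \oo] --> (0 : R).
  rewrite -[X in _ --> X](mulr0 2); apply: cvgMl_tmp.
  exact: cvg_comp _ _ (@ln_nat_cvgy R) (cvgr_expRNM half0).
apply: squeeze_cvgr (cvg_cst _) upper_cvg0; near=> n.
have np : sparse_range n (p n) by near: n; exact: edge_prob_sparse.
rewrite sum_deficient_bound// andbT; apply: sumr_ge0 => k _.
have /andP[q0 _] := card_le1_prob_itv k (sparse_range_p01 np).
by rewrite !mulr_ge0 ?exprn_ge0.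
Unshelve. all: by end_near. Qed.

Lemma edge_prob_le1 : \forall n \near \oo, p n <= 1.
Proof. exact: cvgr_le edge_prob_cvg0 _ ltr01. Qed.

Lemma double_Hall_cvg :
  Gnnp_Pr (p n) (@double_Hall 'I_n 'I_n) @[n --> \oo] --> expR (- expR (- c0)).
Proof.
apply: cvg_sub0
  (cvg_onem_expn deficient_pair_prob_cvg0 bin2_deficient_pair_prob_cvg).
apply/norm_cvg0P.
have error_cvg : n%:R ^+ 3 * deficient_pairs_bound n (7 / 8) (p n) +
    n%:R ^+ 3 * deficient_pair_prob n (p n) ^+ 2 +
    \sum_(3 <= k < n.+1) deficient_bound n n k (p n) @[n --> \oo] -->
    (0 + 0 + 0 : R).
  apply: cvgD sum_deficient_bound_cvg0.
  exact: cvgD cube_deficient_pairs_bound_cvg0 cube_sqr_deficient_pair_prob_cvg0.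
rewrite !addr0 in error_cvg.
apply: squeeze_cvgr (cvg_cst _) error_cvg; near=> n.
have np : sparse_range n (p n) by near: n; exact: edge_prob_sparse.
have n2 : (2 <= n)%N by near: n; exact: nbhs_infty_ge.
rewrite normr_ge0 /= -mulrDr fctE Gnnp_PrE.
have := @double_Hall_approx R 'I_n 'I_n (p n) (7 / 8) _ (sparse_range_p01 np).
by rewrite card_ord leqnn n2; apply => //; lra.
Unshelve. all: by end_near. Qed.

End CriticalWindow.

Section DivergentShift.
Variable R : realType.
Implicit Types (c : nat -> R) (a : R).

Local Notation Pr_double_Hall c n :=
  (Gnnp_Pr (edge_prob c n) (@double_Hall 'I_n 'I_n)).

Lemma Pr_double_Hall_le c c' n : c n <= c' n -> edge_prob c' n <= 1 ->
  Pr_double_Hall c n <= Pr_double_Hall c' n.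
Proof.
move=> cc' p1; rewrite !Gnnp_PrE rset_Pr_double_Hall_mono ?sqrtr_ge0//.
by rewrite ler_wsqrtr// ler_wpM2r ?invr_ge0// lerD2l.
Qed.

Lemma Pr_double_Hall_01 c n : edge_prob c n <= 1 ->
  0 <= Pr_double_Hall c n <= 1.
Proof.
by move=> p1; rewrite Gnnp_PrE rset_Pr_ge0 ?rset_Pr_le1 ?sqrtr_ge0.
Qed.

Lemma edge_prob_cst_le1 a : \forall n \near \oo, edge_prob (fun=> a) n <= 1.
Proof. exact: edge_prob_le1 (cvg_cst a). Qed.

Lemma double_Hall_cvg0 c : (\forall n \near \oo, edge_prob c n <= 1) ->
  c n @[n --> \oo] --> -oo -> Pr_double_Hall c n @[n --> \oo] --> (0 : R).
Proof.
move=> p1 cNy; apply/cvgrPdist_le => e e0; near=> n.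
have /andP[Pr0 _] : 0 <= Pr_double_Hall c n <= 1.
  by apply: Pr_double_Hall_01; near: n.
rewrite sub0r normrN ger0_norm//.
apply: (@le_trans _ _ (Pr_double_Hall (fun=> ln e) n)).
  apply: Pr_double_Hall_le; near: n; last exact: edge_prob_cst_le1.
  exact: cvgrNy_le cNy _.
near: n; apply: cvgr_le (double_Hall_cvg (cvg_cst (ln e))) _ _.
rewrite -[ltRHS]lnK ?posrE// ltr_expR.
have := expR_ge1Dx (- ln e); lra.
Unshelve. all: by end_near. Qed.

Lemma double_Hall_cvg1 c : (\forall n \near \oo, edge_prob c n <= 1) ->
  c n @[n --> \oo] --> +oo -> Pr_double_Hall c n @[n --> \oo] --> (1 : R).
Proof.
move=> p1 cy; apply/cvgrPdist_le => e e0; near=> n.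
have pn1 : edge_prob c n <= 1 by near: n.
have /andP[_ Pr1] := Pr_double_Hall_01 pn1.
rewrite ger0_norm ?subr_ge0// lerBlDr addrC -lerBlDr.
apply: (@le_trans _ _ (Pr_double_Hall (fun=> 1 - ln e) n)); last first.
  by apply: Pr_double_Hall_le => //; near: n; exact: cvgry_ge cy _.
near: n; apply: cvgr_ge (double_Hall_cvg (cvg_cst (1 - ln e))) _ _.
apply: lt_le_trans (expR_ge1Dx _).
rewrite ltrD2l ltrN2 -[ltRHS]lnK ?posrE// ltr_expR; lra.
Unshelve. all: by end_near. Qed.

End DivergentShift.

Theorem theorem1p12 (R : realType) (c : nat -> R)
    (hp : \forall n \near \oo, edge_prob_valid c n) :
  let Pr_dH := fun n : nat =>
    @Gnnp_Pr R n (edge_prob c n) (@double_Hall 'I_n 'I_n) in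
  [/\ c n @[n --> \oo] --> -oo -> Pr_dH n @[n --> \oo] --> (0 : R),
      forall c0 : R, c n @[n --> \oo] --> c0 ->
        Pr_dH n @[n --> \oo] --> expR (- expR (- c0))
    & c n @[n --> \oo] --> +oo -> Pr_dH n @[n --> \oo] --> (1 : R)].
Proof.
have p_le1 : \forall n \near \oo, edge_prob c n <= 1.
  by apply: filterS hp => n [_ /andP[]].
split=> [|c0|].
- exact: double_Hall_cvg0.
- exact: double_Hall_cvg.
- exact: double_Hall_cvg1.
Qed.
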